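(* Let $d\ge 1$ and let $P\subset\mathbb{R}^d$ be a $d$-dimensional perfect prismoid. Then $P$ is affinely equivalent to some lattice Delaunay polytope in $\mathbb{R}^d$; that is, there exist a lattice $\Lambda\subset\mathbb{R}^d$ and a lattice Delaunay polytope $D$ of $\Lambda$ such that $D$ is the image of $P$ under an invertible affine transformation of $\mathbb{R}^d$.
   Context: Polytopes are convex polytopes (convex hulls of finite point sets) in Euclidean space $\mathbb{R}^d$; a $d$-dimensional polytope in $\mathbb{R}^d$ is one whose affine hull is all of $\mathbb{R}^d$. For $X\subset\mathbb{R}^d$, $\operatorname{lin}X$ denotes the linear space associated with the affine hull of $X$, i.e. the set of all combinations $a_1x_1+\dots+a_nx_n$ with $x_i\in X$, $a_i\in\mathbb{R}$ and $a_1+\dots+a_n=0$. A facet of a $d$-dimensional polytope is a $(d-1)$-dimensional face. Let $F$ be a facet of a polytope $P$. $P$ is called a prismoid over $F$ if there is a face $F'$ of $P$ with $\operatorname{lin}F'\subseteq\operatorname{lin}F$ and $P=\operatorname{conv}(F\cup F')$ (the face $F'$ may have smaller dimension than $F$). $P$ is called a perfect prismoid if it is a prismoid over each of its facets. Let $\Lambda$ be a (full-rank) lattice in $\mathbb{R}^d$. A polytope $D$ is called a lattice Delaunay polytope (of $\Lambda$) if there is a ball $B\subset\mathbb{R}^d$ such that $D$ is inscribed in $B$ (all vertices of $D$ lie on the sphere $\partial B$), the interior of $B$ contains no point of $\Lambda$, and $D=\operatorname{conv}(\Lambda\cap\partial B)$. *)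

(* Defs.v *)
From HB Require Import structures.
From mathcomp Require Import all_boot all_order all_algebra.
From mathcomp Require Import boolp classical_sets reals.

Set Implicit Arguments.
Unset Strict Implicit.
Unset Printing Implicit Defensive.

Import Order.TTheory GRing.Theory Num.Theory.
Local Open Scope classical_set_scope.
Local Open Scope ring_scope.

(* R^d is 'rV[R]_d with R : realType.  The norm that MathComp-Analysis puts on
   matrices is the sup norm, hence the explicit Euclidean one. *)
Definition dotp (R : realType) (d : nat) (u v : 'rV[R]_d) : R :=
  \sum_(i < d) u 0 i * v 0 i.

Definition enorm (R : realType) (d : nat) (u : 'rV[R]_d) : R :=
  Num.sqrt (dotp u u).

Definition open_eball (R : realType) (d : nat) (c : 'rV[R]_d) (r : R) :
    set 'rV[R]_d :=
  [set x | enorm (x - c) < r].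

Definition esphere (R : realType) (d : nat) (c : 'rV[R]_d) (r : R) :
    set 'rV[R]_d :=
  [set x | enorm (x - c) = r].

Definition conv_hull (R : realType) (d : nat) (X : set 'rV[R]_d) :
    set 'rV[R]_d :=
  [set v | exists (n : nat) (x : 'I_n -> 'rV[R]_d) (a : 'I_n -> R),
    [/\ forall i, X (x i), forall i, 0 <= a i, \sum_(i < n) a i = 1
      & v = \sum_(i < n) a i *: x i]].

Definition aff_hull (R : realType) (d : nat) (X : set 'rV[R]_d) :
    set 'rV[R]_d :=
  [set v | exists (n : nat) (x : 'I_n -> 'rV[R]_d) (a : 'I_n -> R),
    [/\ forall i, X (x i), \sum_(i < n) a i = 1
      & v = \sum_(i < n) a i *: x i]].

Definition lin (R : realType) (d : nat) (X : set 'rV[R]_d) :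
    set 'rV[R]_d :=
  [set v | exists (n : nat) (x : 'I_n -> 'rV[R]_d) (a : 'I_n -> R),
    [/\ forall i, X (x i), \sum_(i < n) a i = 0
      & v = \sum_(i < n) a i *: x i]].

(* Affine dimension.  Nonemptiness matters: lin set0 = lin [set x] = {0}, but
   only [set x] has dimension 0. *)
Definition has_dim (R : realType) (d : nat) (X : set 'rV[R]_d) (k : nat) :
    Prop :=
  X !=set0 /\
  exists U : {vspace 'rV[R]_d}, lin X = [set v | v \in U] /\ \dim U = k.

Definition is_polytope (R : realType) (d : nat) (P : set 'rV[R]_d) : Prop :=
  exists s : seq 'rV[R]_d, P = conv_hull [set x | x \in s].

Definition full_dimensional (R : realType) (d : nat) (P : set 'rV[R]_d) :
    Prop :=
  aff_hull P = setT.

(* Faces are the sets of maximisers of a linear functional; u = 0 gives the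
   improper faces P (m = 0) and set0 (m > 0). *)
Definition is_face (R : realType) (d : nat) (P F : set 'rV[R]_d) : Prop :=
  exists (u : 'rV[R]_d) (m : R),
    (forall x, P x -> dotp u x <= m) /\ F = [set x | P x /\ dotp u x = m].

Definition is_vertex (R : realType) (d : nat) (P : set 'rV[R]_d)
    (v : 'rV[R]_d) : Prop :=
  is_face P [set v].

Definition is_facet (R : realType) (d : nat) (P F : set 'rV[R]_d) : Prop :=
  is_face P F /\ has_dim F d.-1.

Definition prismoid_over (R : realType) (d : nat) (P F : set 'rV[R]_d) :
    Prop :=
  exists F' : set 'rV[R]_d,
    [/\ is_face P F', lin F' `<=` lin F & P = conv_hull (F `|` F')].

Definition perfect_prismoid (R : realType) (d : nat) (P : set 'rV[R]_d) :
    Prop :=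
  forall F : set 'rV[R]_d, is_facet P F -> prismoid_over P F.

(* Integer combinations of the rows of B, which form a basis of R^d. *)
Definition is_lattice (R : realType) (d : nat) (L : set 'rV[R]_d) : Prop :=
  exists B : 'M[R]_d, B \in unitmx /\
    L = [set v | exists z : 'rV[int]_d, v = map_mx intr z *m B].

Definition lattice_Delaunay (R : realType) (d : nat) (L D : set 'rV[R]_d) :
    Prop :=
  is_polytope D /\
  exists (c : 'rV[R]_d) (r : R),
    [/\ 0 < r,
        forall v, is_vertex D v -> esphere c r v,
        L `&` open_eball c r = set0
      & D = conv_hull (L `&` esphere c r)].

(* Vectors are rows, so the linear part acts on the right. *)
Definition affine_image (R : realType) (d : nat) (A : 'M[R]_d) (b : 'rV[R]_d)
    (P : set 'rV[R]_d) : set 'rV[R]_d :=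
  [set x *m A + b | x in P].

(* Main.v *)
Require Import Defs.
From mathcomp Require Import all_boot all_order all_algebra.
From mathcomp Require Import boolp classical_sets reals.
From mathcomp Require Import ring lra zify.

Set Implicit Arguments.
Unset Strict Implicit.
Unset Printing Implicit Defensive.

Import Order.TTheory GRing.Theory Num.Theory.
Local Open Scope classical_set_scope.
Local Open Scope ring_scope.

(** A perfect prismoid is a polytope that is two-level with respect to each of
    its facets: if [F] is a facet with opposite face [F'], the affine functional
    that is 0 on [F] and 1 on [F'] takes only the values 0 and 1 on the vertices
    ([two_level]), because a vertex of [conv (F `|` F')] lies in [F `|` F']
    ([vertex_conv_hull]).  As a polytope is cut out by its facets
    ([facet_separation]), finitely many such functionals [f_1, ..., f_m] give
    [P = {x | f_k x >= 0 for all k}] ([level_map]).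

    Hence [f = (f_1, ..., f_m)], written [x |-> x *m N + c], embeds R^d in R^m
    as an affine subspace [H] such that [f P] is [H] intersected with the cube
    [0, 1]^m, and [f] sends the vertices of [P] to vertices of the cube.  The
    cube is a Delaunay polytope of Z^m: the squared distance of an integer point
    to the centre (1/2, ..., 1/2) is at least m/4, with equality only at the 0/1
    points ([half_cube_dist]).  Intersecting with [H] keeps this property:
    pull back the lattice Z^m, the Euclidean norm of R^m and the circumscribed
    sphere of the cube along [f].  The preimage of Z^m, translated by a vertex
    to make it contain 0, is a lattice of full rank ([level_lattice]): it is
    discrete since [N] is injective, which is the boundedness of [P], and it
    contains the differences of vertices, which span.  A basis is read off a
    Smith normal form ([integral_lattice]).  The pulled-back norm is the
    standard one after a linear change of coordinates ([pullback_norm], by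
    Cholesky factorization), and the pulled-back ball is centred at the foot of
    the perpendicular from the centre of the cube ([foot_of_perpendicular]).
    In these coordinates [P] is a Delaunay polytope ([level_Delaunay]). *)

(** * The dot product *)

Section Dot.
Variables (R : realType) (d : nat).
Implicit Types (u v w : 'rV[R]_d) (a : R).

Lemma dotpE u v : dotp u v = (u *m v^T) 0 0.
Proof. by rewrite mxE; apply: eq_bigr => i _; rewrite mxE. Qed.

Lemma dotpC u v : dotp u v = dotp v u.
Proof. by apply: eq_bigr => i _; rewrite mulrC. Qed.

Lemma dotpDl u v w : dotp (u + v) w = dotp u w + dotp v w.
Proof. by rewrite !dotpE mulmxDl mxE. Qed.

Lemma dotpZl a u w : dotp (a *: u) w = a * dotp u w.
Proof. by rewrite !dotpE -scalemxAl mxE. Qed.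

Lemma dotpNl u w : dotp (- u) w = - dotp u w.
Proof. by rewrite -scaleN1r dotpZl mulN1r. Qed.

Lemma dotpBl u v w : dotp (u - v) w = dotp u w - dotp v w.
Proof. by rewrite dotpDl dotpNl. Qed.

Lemma dotp0l w : dotp 0 w = 0.
Proof. by rewrite -(scale0r w) dotpZl mul0r. Qed.

Lemma dotpDr u v w : dotp u (v + w) = dotp u v + dotp u w.
Proof. by rewrite dotpC dotpDl !(dotpC u). Qed.

Lemma dotpZr a u w : dotp u (a *: w) = a * dotp u w.
Proof. by rewrite dotpC dotpZl dotpC. Qed.

Lemma dotpBr u v w : dotp u (v - w) = dotp u v - dotp u w.
Proof. by rewrite dotpC dotpBl !(dotpC u). Qed.

Lemma dotp_sumr u n (a : 'I_n -> R) (x : 'I_n -> 'rV[R]_d) :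
  dotp u (\sum_i a i *: x i) = \sum_i a i * dotp u (x i).
Proof.
rewrite dotpE linear_sum mulmx_sumr summxE; apply: eq_bigr => i _.
by rewrite linearZ /= -scalemxAr mxE -dotpE.
Qed.

Lemma dotp_deltar u i : dotp u (delta_mx 0 i) = u 0 i.
Proof.
rewrite /dotp (bigD1 i) //= big1 ?addr0 => [|j /negPf ji].
  by rewrite mxE !eqxx mulr1.
by rewrite mxE ji andbF mulr0.
Qed.

Lemma dotp_ge0 u : 0 <= dotp u u.
Proof. by apply: sumr_ge0 => i _; rewrite -expr2 sqr_ge0. Qed.

Lemma dotp_eq0 u : dotp u u = 0 -> u = 0.
Proof.
move=> /eqP; rewrite psumr_eq0 => [/allP uu0|i _]; last first.
  by rewrite -expr2 sqr_ge0.
apply/rowP => i; rewrite mxE.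
have /uu0 : i \in index_enum 'I_d by rewrite mem_index_enum.
by rewrite /= mulf_eq0 orbb => /eqP.
Qed.

Lemma enorm_sqr u : enorm u ^+ 2 = dotp u u.
Proof. by rewrite sqr_sqrtr // dotp_ge0. Qed.

End Dot.

Lemma dotp_mulmx (R : realType) n k (x : 'rV[R]_n) (A : 'M_(n, k)) y :
  dotp (x *m A) y = dotp x (y *m A^T).
Proof. by rewrite !dotpE trmx_mul trmxK mulmxA. Qed.

(** * Farkas' lemma and convex hulls of finite sets *)

(** Bartl's algebraic proof, by induction on the number of functionals.  If
    [A n] is needed, some [x0] satisfies the other inequalities but has
    [c x0 > 0], hence [A n x0 > 0]; projecting along [x0] onto the kernel of
    [A n] turns the other functionals and [c] into [A'] and [c'], to which the
    induction hypothesis applies. *)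
Lemma farkas (R : realType) (W : lmodType R) (n : nat) (A : nat -> W -> R)
    (c : W -> R) :
    (forall i, scalar (A i)) -> scalar c ->
    (forall x, (forall i, (i < n)%N -> A i x <= 0) -> c x <= 0) ->
  exists l : nat -> R,
    (forall i, 0 <= l i) /\ forall x, c x = \sum_(i < n) l i * A i x.
Proof.
elim: n A c => [|n IH] A c linA linc Ac.
  exists (fun=> 0); split=> // x; rewrite big_ord0.
  have cN : c (- x) = - c x.
    have := linc (-1) x 0; have := linc 1 0 0.
    rewrite scale1r addr0 scaleN1r addr0; lra.
  have := Ac x; have := Ac (- x); rewrite cN => h1 h2.
  have : c x <= 0 by exact: h2.
  have : - c x <= 0 by exact: h1.
  lra.
have [An|] := pselect (forall x, (forall i, (i < n)%N -> A i x <= 0) -> c x <= 0).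
  have [l [l0 cE]] := IH A c linA linc An.
  exists (fun i => if i == n then 0 else l i); split=> [i|x].
    by case: ifP.
  rewrite big_ord_recr /= eqxx mul0r addr0 cE; apply: eq_bigr => i _.
  by rewrite ltn_eqF.
move=> /existsNP[x0 /not_implyP[Ax0 /negP]]; rewrite -ltNge => cx0.
have An0 : 0 < A n x0.
  rewrite ltNge; apply/negP => An0; move: cx0; rewrite ltNge => /negP; apply.
  by apply: Ac => i; rewrite ltnS leq_eqVlt => /orP[/eqP->|/Ax0].
pose q := (A n x0)^-1; have q0 : 0 < q by rewrite invr_gt0.
pose A' i x := A i x - (q * A i x0) * A n x.
pose c' x := c x - (q * c x0) * A n x.
have linA' i : scalar (A' i).
  by move=> b x y; rewrite /A' !linA; ring.
have linc' : scalar c'.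
  by move=> b x y; rewrite /c' linA linc; ring.
have [|l [l0 cE]] := IH A' c' linA' linc'.
  move=> x Ax.
  have := Ac ((- (q * A n x)) *: x0 + x).
  rewrite linc /c' => h; rewrite (_ : _ - _ = - (q * A n x) * c x0 + c x); last ring.
  apply: h => i; rewrite ltnS leq_eqVlt => /orP[/eqP->|iltn]; rewrite linA.
    rewrite (_ : _ + _ = (1 - A n x0 * q) * A n x); last by rewrite /q; ring.
    by rewrite /q divff ?gt_eqF // subrr mul0r.
  by have := Ax i iltn; rewrite /A'; lra.
pose e := q * c x0 - \sum_(i < n) l i * (q * A i x0).
exists (fun i => if i == n then e else l i); split=> [i|x].
  case: ifP => // _; rewrite subr_ge0 (@le_trans _ _ 0) //; last first.
    by rewrite mulr_ge0 // ltW.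
  apply: sumr_le0 => j _; rewrite mulr_ge0_le0 // mulr_ge0_le0 // ?(ltW q0) //.
  exact: Ax0.
have := cE x; rewrite /c' /A' big_ord_recr /= eqxx.
under eq_bigr do rewrite mulrBr mulrA.
rewrite sumrB -mulr_suml => cE'.
rewrite (eq_bigr (fun i : 'I_n => l i * A i x)); last first.
  by move=> i _; rewrite ltn_eqF.
rewrite /e mulrBl; lra.
Qed.

Section ConvexHull.
Variables (R : realType) (d : nat).
Implicit Types (u v w x y : 'rV[R]_d) (s : seq 'rV[R]_d) (X : set 'rV[R]_d).

Lemma conv_hull_le X u m : (forall x, X x -> dotp u x <= m) ->
  forall x, conv_hull X x -> dotp u x <= m.
Proof.
move=> Xum x [n [y [a [Xy a0 a1 ->]]]]; rewrite dotp_sumr.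
rewrite -[leRHS]mul1r -a1 mulr_suml; apply: ler_sum => i _.
by apply: ler_wpM2l => //; exact: Xum.
Qed.

Lemma conv_hullS X Y : X `<=` Y -> conv_hull X `<=` conv_hull Y.
Proof.
move=> XY x [n [y [a [Xy a0 a1 ->]]]]; exists n, y, a; split => // i.
exact/XY/Xy.
Qed.

Lemma sub_conv_hull X : X `<=` conv_hull X.
Proof.
move=> x Xx; exists 1%N, (fun=> x), (fun=> 1); split => //.
  by rewrite big_ord1.
by rewrite big_ord1 scale1r.
Qed.

(** Farkas' lemma on the space of pairs [(u, m)], for the functionals
    [(u, m) |-> dotp u y - m] with [y] in [s]: the coefficients it returns sum to
    1 (evaluate at [(0, -1)]) and express [x] (evaluate at the basis vectors). *)
Lemma conv_seqP s x : conv_hull [set y | y \in s] x <->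
  forall u m, (forall y, y \in s -> dotp u y <= m) -> dotp u x <= m.
Proof.
split=> [sx u m su|H]; first exact: (conv_hull_le su).
pose A (i : nat) (p : 'rV[R]_d * R^o) : R := dotp p.1 (nth 0 s i) - p.2.
pose c (p : 'rV[R]_d * R^o) : R := dotp p.1 x - p.2.
have linA i : scalar (A i).
  by move=> b p q; rewrite /A /= dotpDl dotpZl /GRing.scale /=; ring.
have linc : scalar c.
  by move=> b p q; rewrite /c /= dotpDl dotpZl /GRing.scale /=; ring.
have [|l [l0 cE]] := @farkas R _ (size s) A c linA linc.
  move=> [u m] h; rewrite /c /= subr_le0; apply: H => y ys.
  have := h (index y s); rewrite index_mem /A /= nth_index // subr_le0; exact.
exists (size s), (fun i => nth 0 s i), (fun i => l i); split=> //.
- by move=> i /=; rewrite mem_nth.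
- have := cE (0, -1); rewrite /c /= dotp0l sub0r opprK => ->.
  by apply: eq_bigr => i _; rewrite /A /= dotp0l sub0r opprK mulr1.
- apply/rowP => j; have := cE (delta_mx 0 j, 0).
  rewrite /c /= subr0 dotpC dotp_deltar => ->; rewrite summxE.
  by apply: eq_bigr => i _; rewrite /A /= subr0 dotpC dotp_deltar mxE.
Qed.

(** In a convex combination equal to the unique maximizer [v] of a functional,
    every point with nonzero coefficient maximizes it too, hence is [v]. *)
Lemma vertex_conv_hull X v : is_vertex (conv_hull X) v -> X v.
Proof.
move=> [u [m [Xum vE]]].
have [[n [y [a [Xy a0 a1 vy]]]] uvm] : conv_hull X v /\ dotp u v = m.
  by have : [set v] v by []; rewrite vE.
have le0 i : 0 <= a i * (m - dotp u (y i)).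
  rewrite mulr_ge0 // subr_ge0; exact/Xum/sub_conv_hull.
have : \sum_i a i * (m - dotp u (y i)) = 0.
  under eq_bigr do rewrite mulrBr.
  by rewrite sumrB -mulr_suml a1 mul1r -dotp_sumr -vy uvm subrr.
move/eqP; rewrite psumr_eq0 => [/allP z|i _]; last exact: le0.
have [i ai] : exists i, a i != 0.
  apply: contrapT => /forallNP h; have := @oner_neq0 R; rewrite -a1 big1 ?eqxx // => i _.
  by apply/eqP/negPn/negP; exact: h.
have /z /= : i \in index_enum 'I_n by rewrite mem_index_enum.
rewrite mulf_eq0 (negPf ai) /= subr_eq0 => /eqP my.
suff -> : v = y i by exact: Xy.
suff : [set v] (y i) by move=> /= ->.
by rewrite vE /=; split => //; exact/sub_conv_hull.
Qed.

(** A point outside the convex hull of the other generators is separated from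
    them, by [conv_seqP], and is then the unique maximizer of the separating
    functional. *)
Lemma vertex_or_redundant s v : v \in s ->
  is_vertex (conv_hull [set y | y \in s]) v \/
  conv_hull [set y | y \in [seq y <- s | y != v]] v.
Proof.
move=> vs; have [|nc] := pselect (conv_hull [set y | y \in [seq y <- s | y != v]] v).
  by right.
left; have [u [m [um uv]]] : exists u m,
    (forall y, y \in s -> y != v -> dotp u y <= m) /\ m < dotp u v.
  apply: contrapT => /forallNP h; apply: nc; apply/conv_seqP => u m um.
  rewrite leNgt; apply/negP => uv; case: (h u); exists m; split=> // y ys yv.
  by apply: um; rewrite mem_filter yv.
have sv y : y \in s -> dotp u y <= dotp u v.
  by move=> ys; case: (eqVneq y v) => [->//|yv]; apply/(le_trans (um _ ys yv))/ltW.
exists u, (dotp u v); split; first exact: conv_hull_le.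
apply/seteqP; split=> [_ /= ->|x [[n [y [a [sy a0 a1 xE]]]] uxv]].
  by split=> //; exact: sub_conv_hull.
have le0 i : 0 <= a i * (dotp u v - dotp u (y i)).
  by rewrite mulr_ge0 // subr_ge0; apply: sv; exact: sy.
have : \sum_i a i * (dotp u v - dotp u (y i)) = 0.
  under eq_bigr do rewrite mulrBr.
  by rewrite sumrB -mulr_suml a1 mul1r -dotp_sumr -xE uxv subrr.
move/eqP; rewrite psumr_eq0 => [/allP z|i _]; last exact: le0.
rewrite /= xE -[v]scale1r -a1 scaler_suml; apply: eq_bigr => i _.
have /z /= : i \in index_enum 'I_n by rewrite mem_index_enum.
rewrite mulf_eq0 => /orP[/eqP->|]; first by rewrite !scale0r.
rewrite subr_eq0 => /eqP uE; case: (eqVneq (y i) v) => [->//|yv].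
by have := um _ (sy i) yv; rewrite -uE leNgt uv.
Qed.

(** Discarding redundant generators one at a time leaves only vertices. *)
Lemma polytope_vertices (P : set 'rV[R]_d) : is_polytope P ->
  exists s, P = conv_hull [set y | y \in s] /\
    forall v, v \in s -> is_vertex P v.
Proof.
move=> [s ->{P}]; have [n] := ubnP (size s); elim: n s => // n IH s sn.
have [sv|] := pselect (forall v, v \in s ->
    is_vertex (conv_hull [set y | y \in s]) v).
  by exists s.
move=> /existsNP[v /not_implyP[vs vN]].
case: (vertex_or_redundant vs) => // vr.
have -> : conv_hull [set y | y \in s] =
    conv_hull [set y | y \in [seq y <- s | y != v]].
  apply/seteqP; split; last first.
    by apply: conv_hullS => y /=; rewrite mem_filter => /andP[].
  move=> x /conv_seqP xs; apply/conv_seqP => u m um; apply: xs => y ys.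
  case: (eqVneq y v) => [->|yv]; first by move/conv_seqP: vr; apply.
  by apply: um; rewrite mem_filter yv.
apply: IH; rewrite -ltnS (leq_trans _ sn) // ltnS size_filter.
rewrite -(count_predC (pred1 v)) -[ltnLHS]add0n ltn_add2r.
by rewrite -has_count; apply/hasP; exists v => /=.
Qed.

End ConvexHull.
Local Open Scope ring_scope.
(** * Separation by facets *)

Lemma count_ltn (T : eqType) (a b : pred T) (s : seq T) (z : T) :
    (forall y, y \in s -> a y -> b y) -> z \in s -> b z -> ~~ a z ->
  (count a s < count b s)%N.
Proof.
move=> ab zs bz az; rewrite -(size_filter b) -(count_predC a) !count_filter.
rewrite (@eq_in_count _ (predI a b) a) => [|y ys /=]; last first.
  by case: (a y) (ab y ys) => // ->.
rewrite -[ltnLHS]addn0 ltn_add2l -has_count; apply/hasP; exists z => //=.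
by rewrite az.
Qed.

Section Facets.
Variables (R : realType) (d : nat).
Implicit Types (u v w x y : 'rV[R]_d) (s : seq 'rV[R]_d) (P : set 'rV[R]_d).

Lemma conv_hull_const (X : set 'rV[R]_d) u m : (forall x, X x -> dotp u x = m) ->
  forall x, conv_hull X x -> dotp u x = m.
Proof.
move=> Xum x [n [y [a [Xy a0 a1 ->]]]]; rewrite dotp_sumr.
under eq_bigr do rewrite Xum //.
by rewrite -mulr_suml a1 mul1r.
Qed.

Lemma aff_hull_const (X : set 'rV[R]_d) u m : (forall x, X x -> dotp u x = m) ->
  forall x, aff_hull X x -> dotp u x = m.
Proof.
move=> Xum x [n [y [a [Xy a1 ->]]]]; rewrite dotp_sumr.
under eq_bigr do rewrite Xum //.
by rewrite -mulr_suml a1 mul1r.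
Qed.

Lemma full_dim_const P u m : full_dimensional P ->
  (forall x, P x -> dotp u x = m) -> u = 0.
Proof.
move=> Pfull Pum.
have uE x : dotp u x = m by apply: (aff_hull_const Pum); rewrite Pfull.
by apply: dotp_eq0; rewrite uE -(uE 0) dotpC dotp0l.
Qed.

(** The hyperplane [dotp u y = m] cannot be rotated about the points of [s] that
    it contains while the value at [x] of its affine functional is kept.  For a
    supporting hyperplane that separates [x] from [s], this means that it
    contains d affinely independent points of [s]. *)
Definition rigid s x u m := forall w k,
  (forall y, y \in s -> dotp u y = m -> dotp w y = k) -> dotp w x = k -> w = 0.

(** Rotate the half-space in the direction [(w, k)] up to the first moment
    when its boundary meets a point of [s] that was not on it. *)
Lemma rotate_halfspace s x u m w k y :
    (forall y, y \in s -> dotp u y <= m) -> m < dotp u x ->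
    (forall y, y \in s -> dotp u y = m -> dotp w y = k) -> dotp w x = k ->
    y \in s -> k < dotp w y ->
  exists u' m', [/\ forall y, y \in s -> dotp u' y <= m', m' < dotp u' x,
    forall y, y \in s -> dotp u y = m -> dotp u' y = m' &
    exists2 y, y \in s & dotp u y != m /\ dotp u' y = m'].
Proof.
move=> sum uxm tw wx ys wy.
have ys' : (index y s < size s)%N by rewrite index_mem.
(* the moment when s`_i is met *)
pose F (i : 'I_(size s)) := (m - dotp u s`_i) / (dotp w s`_i - k).
have Pi0 : k < dotp w s`_(Ordinal ys') by rewrite /= nth_index.
case: (Order.TotalTheory.arg_minP (P := fun i : 'I_(size s) => k < dotp w s`_i) F Pi0).
move=> i iw imin; pose t := F i.
have ti : t * (dotp w s`_i - k) = m - dotp u s`_i.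
  by rewrite /t /F divfK // subr_eq0 gt_eqF.
have t0 : 0 <= t.
  by rewrite /t /F divr_ge0 // subr_ge0 ?(ltW iw) // sum // mem_nth.
exists (u + t *: w), (m + t * k); split.
- move=> z zs; rewrite dotpDl dotpZl.
  have [wz|wz] := leP (dotp w z) k.
    by have := sum z zs; have := ler_wpM2l t0 wz; lra.
  have zs' : (index z s < size s)%N by rewrite index_mem.
  have := imin (Ordinal zs'); rewrite /= nth_index // => /(_ wz).
  rewrite -/t /F /= nth_index // ler_pdivlMr ?subr_gt0 //; lra.
- by rewrite dotpDl dotpZl wx ltrD2r.
- by move=> z zs uz; rewrite dotpDl dotpZl uz (tw z zs uz).
- exists s`_i; first by rewrite mem_nth.
  split; last by rewrite dotpDl dotpZl; lra.
  apply/negP => /eqP uz; move: iw; rewrite (tw _ _ uz) ?ltxx //.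
  by rewrite mem_nth.
Qed.

(** Each rotation puts one more point of [s] on the boundary of the half-space,
    so that the process stops at a rigid half-space. *)
Lemma exists_rigid s x u m : full_dimensional (conv_hull [set y | y \in s]) ->
    (forall y, y \in s -> dotp u y <= m) -> m < dotp u x ->
  exists u' m', [/\ forall y, y \in s -> dotp u' y <= m', m' < dotp u' x &
    rigid s x u' m'].
Proof.
move=> full; have [n] := ubnP (count (fun y => dotp u y != m) s).
elim: n u m => // n IH u m cn sum uxm.
have [|] := pselect (rigid s x u m); first by exists u, m.
move=> /existsNP[w /existsNP[k /not_implyP[tw /not_implyP[wx wN]]]].
have [y ys wy] : exists2 y, y \in s & dotp w y != k.
  apply: contrapT => h; apply: wN; apply: (full_dim_const (m := k) full).
  apply: conv_hull_const => y ys; apply: contrapT => /eqP wy; apply: h.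
  by exists y.
have [u' [m' [sum' uxm' tt [z zs [uz uz']]]]] : exists u' m',
    [/\ forall y, y \in s -> dotp u' y <= m', m' < dotp u' x,
    forall y, y \in s -> dotp u y = m -> dotp u' y = m' &
    exists2 y, y \in s & dotp u y != m /\ dotp u' y = m'].
  move: wy; rewrite neq_lt => /orP[wy|wy]; last first.
    exact: (rotate_halfspace sum uxm tw wx ys wy).
  apply: (@rotate_halfspace s x u m (- w) (- k) y) => //.
  - by move=> z zs uz; rewrite dotpNl (tw z zs uz).
  - by rewrite dotpNl wx.
  - by rewrite dotpNl ltrN2.
apply: (IH u' m') => //; rewrite -ltnS (leq_trans _ cn) // ltnS.
apply: (count_ltn (z := z)) => // [y' y's|].
  by apply: contra_neq; exact: tt.
by rewrite uz' eqxx.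
Qed.

Lemma lin_sub (X : set 'rV[R]_d) x y : X x -> X y -> lin X (x - y).
Proof.
move=> Xx Xy; exists 2, (fun i : 'I_2 => if i == 0 then x else y),
  (fun i : 'I_2 => if i == 0 then 1 else -1); split.
- by move=> i; case: ifP.
- by rewrite !big_ord_recl big_ord0 /= addr0 subrr.
- by rewrite !big_ord_recl big_ord0 /= addr0 scale1r scaleN1r.
Qed.

Lemma lin_orthogonal (X : set 'rV[R]_d) u m v :
  (forall x, X x -> dotp u x = m) -> lin X v -> dotp u v = 0.
Proof.
move=> Xum [n [y [a [Xy a0 ->]]]]; rewrite dotp_sumr.
under eq_bigr do rewrite Xum //.
by rewrite -mulr_suml a0 mul0r.
Qed.

Lemma dim_orthogonal u : u != 0 ->
  exists U : {vspace 'rV[R]_d},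
    (forall v, (v \in U) = (dotp u v == 0)) /\ \dim U = d.-1.
Proof.
move=> u0; pose f : 'Hom('rV[R]_d, 'rV[R]_1) := linfun (mulmxr u^T).
have fE v : (f v == 0) = (dotp u v == 0).
  rewrite lfunE /= dotpC dotpE; apply/eqP/eqP => [->|vu]; first by rewrite mxE.
  by apply/rowP => i; rewrite ord1 vu mxE.
exists (lker f); split=> [v|]; first by rewrite memv_ker fE.
have := limg_ker_dim f fullv; rewrite capfv dimvf dim_matrix mul1r.
suff -> : \dim (f @: fullv) = 1%N by move/(congr1 predn); rewrite addn1.
apply/eqP; rewrite eqn_leq; apply/andP; split.
  by rewrite (leq_trans (dimvS (subvf _))) // dimvf dim_matrix.
rewrite lt0n dimv_eq0; apply/negP => /eqP f0.
have : f u \in (f @: fullv)%VS by rewrite memv_img ?memvf.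
rewrite f0 memv0 fE => /eqP /dotp_eq0 uE; by rewrite uE eqxx in u0.
Qed.

(** The differences of the points of [s] on a rigid hyperplane span the space
    orthogonal to [u]: a vector orthogonal to all of them is, up to a multiple
    of [u] chosen to vanish at [x], a direction of rotation. *)
Lemma rigid_facet s x u m : (0 < d)%N ->
    (forall y, y \in s -> dotp u y <= m) -> m < dotp u x -> rigid s x u m ->
  let P := conv_hull [set y | y \in s] in
  is_facet P [set y | P y /\ dotp u y = m].
Proof.
move=> d0 sum uxm rig P.
have Pum : forall y, P y -> dotp u y <= m by exact: conv_hull_le.
split; first by exists u, m.
have [t ts ut] : exists2 t, t \in s & dotp u t = m.
  (* with no point of s on the hyperplane, any direction is a rotation *)
  apply: contrapT => h; have := @rig (delta_mx 0 (Ordinal d0)) (x 0 (Ordinal d0)).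
  rewrite dotpC dotp_deltar => H.
  suff /rowP/(_ (Ordinal d0)) : delta_mx 0 (Ordinal d0) = 0 :> 'rV[R]_d.
    by rewrite !mxE !eqxx => /eqP; rewrite oner_eq0.
  by apply: H => // y ys uy; case: h; exists y.
have Pt : P t by exact: sub_conv_hull.
split; first by exists t.
have u0 : u != 0.
  by apply: contraTneq uxm => u0; rewrite -ut u0 !dotp0l ltxx.
have [U [UE dimU]] := dim_orthogonal u0.
exists U; split=> //; apply/seteqP; split=> v /=.
  move=> lv; rewrite UE; apply/eqP; apply: (lin_orthogonal (m := m) _ lv).
  by move=> y [].
rewrite UE => /eqP uv.
(* off the hyperplane, t is a dummy that contributes a zero row to K *)
pose p (i : 'I_(size s)) := if dotp u s`_i == m then s`_i else t.
have Fp i : [set y | P y /\ dotp u y = m] (p i).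
  rewrite /p; case: ifPn => [/eqP|]; split => //.
  by apply: sub_conv_hull; rewrite /= mem_nth.
pose K := \matrix_i (p i - t).
have [z vE] : exists z, v = z *m K.
  apply/submxP; rewrite submxE; apply/eqP/rowP => j.
  pose w := (col j (cokermx K))^T.
  have wE y : (y *m cokermx K) 0 j = dotp y w.
    by rewrite mxE; apply: eq_bigr => l _; rewrite !mxE.
  rewrite wE mxE.
  have wt y : y \in s -> dotp u y = m -> dotp w y = dotp w t.
    move=> ys uy; have ys' : (index y s < size s)%N by rewrite index_mem.
    apply/eqP; rewrite -subr_eq0 -dotpBr dotpC -wE.
    suff -> : y - t = row (Ordinal ys') K.
      by rewrite -row_mul mulmx_coker !mxE.
    by rewrite rowK /p /= nth_index // uy eqxx.
  (* w - e *: u, with level dotp w t - e * m, is constant on the points of the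
     hyperplane and takes that value at x *)
  have ux0 : dotp u x - m != 0 by rewrite subr_eq0 gt_eqF.
  pose e := (dotp w x - dotp w t) / (dotp u x - m).
  have eE : e * (dotp u x - m) = dotp w x - dotp w t by rewrite /e divfK.
  have := rig (w - e *: u) (dotp w t - e * m).
  rewrite dotpBl dotpZl => H.
  have /eqP : w - e *: u = 0.
    apply: H; last by lra.
    by move=> y ys uy; rewrite dotpBl dotpZl uy (wt y ys uy).
  by rewrite subr_eq0 => /eqP ->; rewrite dotpC dotpZl uv mulr0.
exists (size s).+1, (fun i => if unlift ord0 i is Some j then p j else t),
  (fun i => if unlift ord0 i is Some j then z 0 j else - \sum_j z 0 j); split.
- by move=> i; case: unliftP => // _; split.
- rewrite big_ord_recl unlift_none; under [X in _ + X]eq_bigr do rewrite liftK.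
  by rewrite addNr.
- rewrite big_ord_recl unlift_none; under [X in _ + X]eq_bigr do rewrite liftK.
  rewrite vE mulmx_sum_row; under [LHS]eq_bigr do rewrite rowK scalerBr.
  by rewrite sumrB -scaler_suml scaleNr addrC.
Qed.
(** Farkas' lemma gives a separating half-space, and rotation makes it one that
    is bounded by the hyperplane of a facet. *)
Lemma facet_separation s x : (0 < d)%N ->
    let P := conv_hull [set y | y \in s] in full_dimensional P -> ~ P x ->
  exists u m, [/\ forall y, P y -> dotp u y <= m, m < dotp u x &
    is_facet P [set y | P y /\ dotp u y = m]].
Proof.
move=> d0 P Pfull nPx.
have [u [m [um ux]]] : exists u m,
    (forall y, y \in s -> dotp u y <= m) /\ m < dotp u x.
  apply: contrapT => /forallNP h; apply: nPx; apply/conv_seqP => u m um.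
  by rewrite leNgt; apply/negP => ux; case: (h u); exists m.
have [u' [m' [um' ux' rig]]] := exists_rigid Pfull um ux.
exists u', m'; split=> //; first exact: conv_hull_le.
exact: rigid_facet rig.
Qed.

(** * Affine functionals with values 0 and 1 on the vertices *)

(** The functional is normalized to be 0 on a facet [F] that separates [x] from
    [P] and 1 on the opposite face [F'], on which it is constant since [lin F']
    is contained in [lin F]. *)
Lemma two_level P s x : (0 < d)%N -> perfect_prismoid P -> full_dimensional P ->
    P = conv_hull [set y | y \in s] -> (forall v, v \in s -> is_vertex P v) ->
    ~ P x ->
  exists u m, (forall v, v \in s -> dotp u v + m = 0 \/ dotp u v + m = 1) /\
    dotp u x + m < 0.
Proof.
move=> d0 Pperf Pfull PE Pvert nPx.
have [u [m [um ux]]] : exists u m, [/\ forall y, P y -> dotp u y <= m,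
    m < dotp u x & is_facet P [set y | P y /\ dotp u y = m]].
  by rewrite PE; apply: facet_separation => //; rewrite -PE.
set F := [set y | _] => Ffacet; have [F' [F'face linF' PFF']] := Pperf _ Ffacet.
have FF'P : F `|` F' `<=` P by rewrite PFF'; exact: sub_conv_hull.
have nconst : ~ forall y, P y -> dotp u y = m.
  move=> Pum; have u0 := full_dim_const Pfull Pum; rewrite u0 dotp0l in ux.
  have [z Pz] : P !=set0 by case: Ffacet => _ [[z [Pz _]] _]; exists z.
  by have := Pum z Pz; rewrite u0 dotp0l => m0; rewrite -m0 ltxx in ux.
have [y0 F'y0] : exists y, F' y.
  apply: contrapT => /forallNP h; apply: nconst.
  rewrite PFF'; apply: conv_hull_const => y [[]//|/h//].
have F'u y : F' y -> dotp u y = dotp u y0.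
  move=> F'y; apply/eqP; rewrite -subr_eq0 -dotpBr; apply/eqP.
  apply: (@lin_orthogonal F u m) => [z []//|].
  by apply: linF'; exact: lin_sub.
have y0m : dotp u y0 < m.
  rewrite lt_neqAle um ?andbT; last by apply: FF'P; right.
  apply/eqP => y0m; apply: nconst; rewrite PFF'.
  by apply: conv_hull_const => y [[]//|/F'u ->].
have D0 : m - dotp u y0 != 0 by rewrite subr_eq0 gt_eqF.
pose q := (m - dotp u y0)^-1.
have q0 : 0 < q by rewrite invr_gt0 subr_gt0.
have qE y : dotp (- q *: u) y + q * m = q * (m - dotp u y) by rewrite dotpZl; ring.
exists (- q *: u), (q * m); split=> [v vs|].
  rewrite qE; have := Pvert v vs; rewrite PFF' => /vertex_conv_hull[[_ ->]|/F'u ->].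
    by left; rewrite subrr mulr0.
  by right; rewrite /q mulVf.
by rewrite qE pmulr_rlt0 // subr_lt0.
Qed.
End Facets.
(** * Cholesky factorization *)

(** Induction on the dimension, splitting off the first coordinate: the Schur
    complement [e'] is again positive definite, since its value at [y] is that
    of [G] at [row_mx z y] for the minimizing [z]. *)
Lemma cholesky (R : realType) d (G : 'M[R]_d) : G^T = G ->
    (forall x : 'rV_d, x != 0 -> 0 < dotp (x *m G) x) ->
  exists A : 'M[R]_d, A *m A^T = G.
Proof.
elim: d G => [|d IH] G Gsym Gpos.
  by exists 0; apply/matrixP => -[].
move: G Gsym Gpos; rewrite -[d.+1]/(1 + d)%N => G Gsym Gpos.
pose a : R := G 0 0; pose b := ursubmx G; pose e := drsubmx G.
have GE : G = block_mx a%:M b b^T e.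
  rewrite -[LHS]submxK; congr block_mx; last by rewrite /b trmx_ursub Gsym.
  by apply/rowP => i; rewrite !ord1 !mxE eqxx mulr1n; congr (G _ _); apply: val_inj.
have esym : e^T = e by rewrite trmx_drsub Gsym.
have a0 : 0 < a.
  have : delta_mx 0 0 != 0 :> 'rV[R]_(1 + d).
    by apply/eqP => /rowP/(_ 0); rewrite !mxE !eqxx => /eqP; rewrite oner_eq0.
  by move/Gpos; rewrite dotp_deltar -rowE mxE.
pose e' := e - a^-1 *: (b^T *m b).
have [||A AE] := IH e'.
- by rewrite linearB linearZ /= trmx_mul trmxK esym.
- move=> y y0; pose z := - a^-1 *: (y *m b^T).
  have x0 : row_mx z y != 0.
    by apply: contraNneq y0 => x0; rewrite -(row_mxKr z y) x0 linear0.
  have := Gpos _ x0; rewrite GE mul_row_block !dotpE tr_row_mx mul_row_col.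
  suff -> : z *m a%:M + y *m b^T = 0.
    rewrite mul0mx add0r /e' mulmxBr /z -scalemxAr -scalemxAl mulmxA.
    by rewrite scaleNr addrC.
  by rewrite mul_mx_scalar /z scalerA mulrN divff ?gt_eqF // scaleN1r addNr.
pose q := Num.sqrt a; have q2 : q * q = a by rewrite -expr2 sqr_sqrtr // ltW.
have q0 : q != 0 by rewrite gt_eqF // sqrtr_gt0.
exists (block_mx q%:M 0 (q^-1 *: b^T) A).
rewrite tr_block_mx mulmx_block GE !trmx0 !mulmx0 !mul0mx !addr0 tr_scalar_mx.
rewrite linearZ /= trmxK AE -!scalemxAl -!scalemxAr !mul_scalar_mx !mul_mx_scalar.
rewrite !scalerA mulVf // !scale1r -invfM q2 /e' addrC subrK.
by rewrite scale_scalar_mx q2.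
Qed.

(** * Lattices *)

Section Lattice.
Variables (R : realType) (d : nat).

Lemma lattice_image (L : set 'rV[R]_d) (A : 'M[R]_d) : A \in unitmx ->
  is_lattice L -> is_lattice [set x *m A | x in L].
Proof.
move=> Au [B [Bu ->]]; exists (B *m A); split; first by rewrite unitmx_mul Bu.
apply/seteqP; split=> v /= [].
  by move=> _ [z ->] <-; exists z; rewrite mulmxA.
by move=> z ->; exists (map_mx intr z *m B); [exists z | rewrite mulmxA].
Qed.

Lemma kernel0_unitmx (A : 'M[R]_d) :
  (forall x : 'rV_d, x *m A = 0 -> x = 0) -> A \in unitmx.
Proof.
by move=> A0; rewrite -row_free_unit; exact: inj_row_free.
Qed.

(** In the basis [W] the condition says that a row vector times the integer
    matrix [M] is integral.  After unimodular changes of coordinates [M] is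
    diagonal with nonzero entries [e`_i], and the condition becomes
    [y 0 i * e`_i] integral for all [i]: the lattice is spanned by the basis
    vectors divided by the [e`_i]. *)
Lemma integral_lattice m (N : 'M[R]_(d, m)) (W : 'M[R]_d) (M : 'M[int]_(d, m)) :
    W \in unitmx -> W *m N = map_mx intr M ->
    (forall x : 'rV_d, x *m N = 0 -> x = 0) ->
  is_lattice [set x | exists z : 'rV[int]_m, x *m N = map_mx intr z].
Proof.
move=> Wu WN injN.
have [L Lu [Q Qu [e _ ME]]] := int_Smith_normal_form M.
pose f n k (X : 'M[int]_(n, k)) : 'M[R]_(n, k) := map_mx intr X.
have fM n k l (X : 'M_(n, k)) (Y : 'M_(k, l)) : f _ _ (X *m Y) = f _ _ X *m f _ _ Y.
  exact: map_mxM.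
have fV n (X : 'M_n) : X \in unitmx -> f _ _ (invmx X) *m f _ _ X = 1%:M.
  by move=> Xu; rewrite -fM mulVmx // /f map_mx1.
have fV' n (X : 'M_n) : X \in unitmx -> f _ _ X *m f _ _ (invmx X) = 1%:M.
  by move=> Xu; rewrite -fM mulmxV // /f map_mx1.
have fu n (X : 'M_n) : X \in unitmx -> f _ _ X \in unitmx.
  by move=> Xu; have /mulmx1_unit[] := fV' _ _ Xu.
pose S : 'M[int]_(d, m) := \matrix_(i, j) (e`_i *+ (i == j :> nat)).
have WNE : W *m N = f _ _ L *m f _ _ S *m f _ _ Q by rewrite WN {1}ME -!fM.
(* the rows of T are the basis adapted to the Smith form *)
pose T := f _ _ (invmx L) *m W.
have Tu : T \in unitmx by rewrite unitmx_mul fu ?unitmx_inv.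
have TN : T *m N = f _ _ S *m f _ _ Q.
  by rewrite /T -mulmxA WNE !mulmxA fV // mul1mx.
clearbody T.
(* a missing or zero diagonal entry would give a nonzero kernel vector of N *)
have e0 (i : 'I_d) : (i < m)%N && (e`_i != 0).
  apply/negPn/negP => ei.
  have : (delta_mx 0 i : 'rV[R]_d) *m T = 0.
    apply: injN; rewrite -mulmxA TN mulmxA.
    suff -> : (delta_mx 0 i : 'rV[R]_d) *m f _ _ S = 0 by rewrite mul0mx.
    apply/rowP => j; rewrite -rowE !mxE.
    have [ij|] := eqVneq (i : nat) j; last by rewrite mulr0n.
    by move: ei; rewrite ij ltn_ord /= negbK => /eqP ->; rewrite mul0rn.
  move/(congr1 (mulmx^~ (invmx T))); rewrite mulmxK // mul0mx => /rowP/(_ i).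
  by rewrite !mxE !eqxx => /eqP; rewrite oner_eq0.
have i_m (i : 'I_d) : (i < m)%N by case/andP: (e0 i).
have e_0 (i : 'I_d) : (e`_i)%:~R != 0 :> R by rewrite intr_eq0; case/andP: (e0 i).
pose E : 'rV[R]_d := \row_i (e`_i)%:~R^-1.
have Eu : diag_mx E \in unitmx.
  rewrite unitmxE det_diag unitfE; apply/prodf_neq0 => i _.
  by rewrite mxE invr_eq0.
have yS (y : 'rV[R]_d) (j : 'I_m) (i : 'I_d) : i = j :> nat ->
    (y *m f _ _ S) 0 j = y 0 i * (e`_i)%:~R.
  move=> ij; rewrite mxE (bigD1 i) //= big1 ?addr0 => [|k ki].
    by rewrite !mxE ij eqxx mulr1n.
  rewrite !mxE -ij; case: eqP => [ki'|]; last by rewrite mulr0n mulr0.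
  by rewrite (val_inj ki') eqxx in ki.
have yS0 (y : 'rV[R]_d) (j : 'I_m) : (d <= j)%N -> (y *m f _ _ S) 0 j = 0.
  move=> dj; rewrite mxE big1 // => k _; rewrite !mxE.
  by rewrite ltn_eqF ?mulr0n ?mulr0 // (leq_trans (ltn_ord k)).
exists (diag_mx E *m T); split; first by rewrite unitmx_mul Eu.
apply/seteqP; split=> x /= [z xE].
  have [y xy] : exists y, x = y *m T by exists (x *m invmx T); rewrite mulmxKV.
  pose t := z *m invmx Q.
  have yt : y *m f _ _ S = f _ _ t.
    rewrite /t fM -[f _ _ z]xE xy -!mulmxA.
    by rewrite (mulmxA T) TN -!mulmxA fV' // mulmx1.
  clearbody t; exists (\row_i t 0 (Ordinal (i_m i))).
  rewrite mulmxA xy; congr (_ *m T); apply/rowP => i; rewrite mul_mx_diag !mxE.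
  have := yS y (Ordinal (i_m i)) i erefl; rewrite yt mxE => ->.
  by rewrite mulfK.
pose t : 'rV[int]_m := \row_j (if insub (j : nat) is Some i then z 0 i else 0).
exists (t *m Q); rewrite [RHS]fM xE -mulmxA -mulmxA TN !mulmxA; congr (_ *m _).
apply/rowP => j; rewrite [RHS]mxE [t 0 j]mxE.
case: insubP => [i _ ij|]; last by rewrite -leqNgt => dj; rewrite yS0.
by rewrite (yS _ j i ij) mul_mx_diag !mxE divfK.
Qed.

End Lattice.
(** * The embedding of a perfect prismoid into a cube *)

Section LevelMap.
Variables (R : realType) (d : nat).
Implicit Types (x y v : 'rV[R]_d) (s : seq 'rV[R]_d) (P : set 'rV[R]_d).

(** As [P] is full-dimensional, an affine functional is determined by its
    values on [s], so that there are finitely many with values 0 and 1 there, indexed by the subsets [T] of [s]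
    on which they are 1.  All of them are used, facet or not, and a subset that
    comes from no functional gets the zero functional. *)
Lemma level_map P s : (0 < d)%N -> perfect_prismoid P -> full_dimensional P ->
    P = conv_hull [set y | y \in s] -> (forall v, v \in s -> is_vertex P v) ->
  exists m (N : 'M[R]_(d, m)) (c : 'rV[R]_m),
    (forall v k, v \in s -> (v *m N + c) 0 k = 0 \/ (v *m N + c) 0 k = 1) /\
    (forall x, (forall k, 0 <= (x *m N + c) 0 k) -> P x).
Proof.
move=> d0 Pperf Pfull PE Pvert.
pose lev (p : 'rV[R]_d * R) x := dotp p.1 x + p.2.
have lev_ext p q : (forall v, v \in s -> lev p v = lev q v) ->
    forall x, lev p x = lev q x.
  move=> pq x; have := @aff_hull_const R d P (p.1 - q.1) (q.2 - p.2).
  rewrite Pfull => /(_ _ x I); rewrite dotpBl => H.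
  have : dotp p.1 x - dotp q.1 x = q.2 - p.2; last by rewrite /lev; lra.
  apply: H => y; rewrite PE => Py; apply: conv_hull_const Py => v vs.
  by rewrite dotpBl; have := pq v vs; rewrite /lev; lra.
have /choice[g gP] : forall T : {set 'I_(size s)}, exists p,
    (forall v, v \in s -> lev p v = 0 \/ lev p v = 1) /\
    (forall q, (forall i : 'I_(size s), lev q s`_i = (i \in T)%:R) ->
      forall x, lev q x = lev p x).
  move=> T.
  have [[p pT]|nT] := pselect (exists p, forall i : 'I_(size s), lev p s`_i = (i \in T)%:R).
    exists p; split=> [v vs|q qT].
      have vs' : (index v s < size s)%N by rewrite index_mem.
      rewrite -(nth_index 0 vs) (pT (Ordinal vs')).
      by case: (_ \in T); [right|left].
    apply: lev_ext => v vs; have vs' : (index v s < size s)%N by rewrite index_mem.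
    by rewrite -(nth_index 0 vs) (qT (Ordinal vs')) (pT (Ordinal vs')).
  exists (0, 0); split=> [v vs|q qT]; first by left; rewrite /lev dotp0l addr0.
  by case: nT; exists q.
pose h (k : 'I_#|{set 'I_(size s)}|) := g (enum_val k).
exists #|{set 'I_(size s)}|, (\matrix_(i, k) (h k).1 0 i), (\row_k (h k).2).
have hE x k : (x *m (\matrix_(i, k) (h k).1 0 i) + \row_k (h k).2) 0 k = lev (h k) x.
  rewrite !mxE; congr (_ + _); apply: eq_bigr => i _; by rewrite mxE mulrC.
split=> [v k vs|x xpos]; first by rewrite hE; exact: (gP _).1.
apply: contrapT => nPx; have [u [m [uv ux]]] := two_level d0 Pperf Pfull PE Pvert nPx.
pose T := [set i : 'I_(size s) | lev (u, m) s`_i == 1]%SET.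
have := xpos (enum_rank T); rewrite hE /h enum_rankK leNgt -((gP T).2 (u, m)).
  by rewrite /lev /= ux.
move=> i; rewrite inE; have := uv s`_i (mem_nth _ (ltn_ord i)).
by rewrite /lev /= => -[] ->; rewrite ?eqxx // eq_sym oner_eq0.
Qed.

(** The functional [dotp x] is bounded on a polytope but grows along the ray at
    the rate [dotp x x]. *)
Lemma unbounded_ray s x v : (forall t : R, conv_hull [set y | y \in s] (v + t *: x)) ->
  x = 0.
Proof.
move=> ray; apply: dotp_eq0.
have [M sM] : exists M, forall y, y \in s -> dotp x y <= M.
  elim: (s) => [|y r [M rM]]; first by exists 0.
  exists (Num.max M (dotp x y)) => z; rewrite in_cons le_max.
  by move=> /orP[/eqP->|/rM->//]; rewrite lexx orbT.
have [//|xx] := eqVneq (dotp x x) 0.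
have := conv_hull_le sM (ray ((M - dotp x v + 1) / dotp x x)).
by rewrite dotpDr dotpZr divfK //; lra.
Qed.

(** A functional that vanishes on all the differences is constant on [s], so it
    is zero: the differences span, and a basis can be extracted from them. *)
Lemma vertex_basis s v0 : full_dimensional (conv_hull [set y | y \in s]) ->
  exists W : 'M[R]_d, W \in unitmx /\
    forall i, exists2 v, v \in s & row i W = v - v0.
Proof.
move=> full; pose K := \matrix_(i < size s) (s`_i - v0).
have Kfull : row_full K.
  rewrite -cokermx_eq0; apply/eqP/matrixP => i j; rewrite [RHS]mxE.
  pose w := (col j (cokermx K))^T.
  have wE y : (y *m cokermx K) 0 j = dotp w y.
    by rewrite dotpC mxE; apply: eq_bigr => l _; rewrite !mxE.
  have -> : cokermx K i j = w 0 i by rewrite !mxE.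
  rewrite (full_dim_const (u := w) (m := dotp w v0) full) ?mxE //.
  apply: conv_hull_const => y ys; apply/eqP; rewrite -subr_eq0 -dotpBr -wE.
  have ys' : (index y s < size s)%N by rewrite index_mem.
  have -> : y - v0 = row (Ordinal ys') K by rewrite rowK /= nth_index.
  by rewrite -row_mul mulmx_coker !mxE.
exists (rowsub (fullrankfun Kfull) K); split; first exact: fullrowsub_unit.
move=> i; exists s`_(fullrankfun Kfull i); first by rewrite mem_nth.
by apply/rowP => j; rewrite !mxE.
Qed.

End LevelMap.

(** * Pulling back a Euclidean norm *)

Section Ellipsoid.
Variables (R : realType) (d m : nat) (N : 'M[R]_(d, m)).
Hypothesis injN : forall x : 'rV_d, x *m N = 0 -> x = 0.

Lemma pullback_norm : exists A : 'M[R]_d, A \in unitmx /\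
  forall x : 'rV_d, dotp (x *m A) (x *m A) = dotp (x *m N) (x *m N).
Proof.
have [||A AE] := @cholesky R d (N *m N^T).
- by rewrite trmx_mul trmxK.
- move=> x x0; rewrite mulmxA dotp_mulmx trmxK lt_neqAle dotp_ge0 andbT.
  by apply: contra_neq x0 => /esym/dotp_eq0/injN.
have AN (x : 'rV_d) : dotp (x *m A) (x *m A) = dotp (x *m N) (x *m N).
  by rewrite !dotp_mulmx -!mulmxA AE.
exists A; split=> //; apply: kernel0_unitmx => x xA.
by apply/injN/dotp_eq0; rewrite -AN xA dotp0l.
Qed.

(** Pythagoras: [x0 *m N + e] is the component of [e] orthogonal to the range of
    [N], so the preimage of a sphere centred at [- e] is, for the pulled-back
    norm, a sphere centred at [x0]. *)
Lemma foot_of_perpendicular (e : 'rV[R]_m) : exists x0 : 'rV[R]_d,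
  forall x, dotp (x *m N + e) (x *m N + e) =
    dotp ((x - x0) *m N) ((x - x0) *m N) + dotp (x0 *m N + e) (x0 *m N + e).
Proof.
have Gu : N *m N^T \in unitmx.
  apply: kernel0_unitmx => x xG; apply/injN/dotp_eq0.
  by rewrite dotp_mulmx -mulmxA xG dotpC dotp0l.
pose x0 := - (e *m N^T *m invmx (N *m N^T)); exists x0 => x.
have orth : (x0 *m N + e) *m N^T = 0.
  by rewrite mulmxDl -mulmxA /x0 mulNmx mulmxKV // addNr.
have -> : x *m N + e = (x - x0) *m N + (x0 *m N + e).
  by rewrite mulmxBl addrA subrK.
set y := (x - x0); set w := x0 *m N + e.
have yw : dotp (y *m N) w = 0 by rewrite dotp_mulmx orth dotpC dotp0l.
clearbody y w; by rewrite dotpDl !dotpDr (dotpC w (y *m N)) !yw addr0 add0r.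
Qed.

End Ellipsoid.

Lemma sub_half_sqr (R : realType) (z : int) :
  [/\ (z%:~R - 2^-1) ^+ 2 = 4^-1 + (z * (z - 1))%:~R :> R, 0 <= z * (z - 1) &
    z * (z - 1) = 0 -> z = 0 \/ z = 1].
Proof.
split; first by rewrite intrM intrB; field.
  by nia.
by move=> /eqP; rewrite mulf_eq0 subr_eq0 => /orP[]/eqP; [left|right].
Qed.
Section AffineMaps.
Variables (R : realType) (d : nat).

Lemma affine_comb k (A : 'M[R]_(d, k)) b n (a : 'I_n -> R) (x : 'I_n -> 'rV[R]_d) :
  \sum_i a i = 1 ->
  (\sum_i a i *: x i) *m A + b = \sum_i a i *: (x i *m A + b).
Proof.
move=> a1; under [RHS]eq_bigr do rewrite scalerDr.
rewrite big_split /= -scaler_suml a1 scale1r mulmx_suml.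
by congr (_ + _); apply: eq_bigr => i _; rewrite scalemxAl.
Qed.

Lemma affine_image_conv (A : 'M[R]_d) b X :
  affine_image A b (conv_hull X) = conv_hull (affine_image A b X).
Proof.
apply/seteqP; split=> [_ [_ [n [y [a [Xy a0 a1 ->]]]] <-]|_ [n [y [a [Xy a0 a1 ->]]]]].
  exists n, (fun i => y i *m A + b), a; split=> // [i|]; first by exists (y i).
  exact: affine_comb.
have /choice[x xP] : forall i, exists x, X x /\ x *m A + b = y i.
  by move=> i; have [x Xx xE] := Xy i; exists x.
exists (\sum_i a i *: x i).
  by exists n, x, a; split=> // i; exact: (xP i).1.
by rewrite affine_comb //; apply: eq_bigr => i _; rewrite (xP i).2.
Qed.

End AffineMaps.

(** * The pulled-back sphere of the cube is a Delaunay sphere *)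

Section DelaunaySphere.
Variables (R : realType) (d m : nat) (N : 'M[R]_(d, m)) (c : 'rV[R]_m).
Variables (s : seq 'rV[R]_d).
Implicit Types x y v : 'rV[R]_d.
Local Notation P := (conv_hull [set y | y \in s]).
Hypothesis d_gt0 : (0 < d)%N.
Hypothesis Pfull : full_dimensional P.
Hypothesis level01 : forall v k, v \in s ->
  (v *m N + c) 0 k = 0 \/ (v *m N + c) 0 k = 1.
Hypothesis level_ge0 : forall x, (forall k, 0 <= (x *m N + c) 0 k) -> P x.

Lemma level_int v : v \in s -> exists z : 'rV[int]_m, v *m N + c = map_mx intr z.
Proof.
move=> vs; exists (\row_k ((v *m N + c) 0 k == 1)%:Z); apply/rowP => k.
rewrite [RHS]mxE [X in _ = intr X]mxE.
by have [->|->] := level01 k vs; rewrite ?eqxx // eq_sym oner_eq0.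
Qed.

Lemma level_ge0P x : P x -> forall k, 0 <= (x *m N + c) 0 k.
Proof.
move=> Px k.
have [n [y [a [ys a0 a1 ->]]]] := Px.
rewrite affine_comb // summxE; apply: sumr_ge0 => i _.
by rewrite mxE mulr_ge0 //; have [->|->] := level01 k (ys i).
Qed.

Lemma level_diff_int v v0 : v \in s -> v0 \in s ->
  exists z : 'rV[int]_m, (v - v0) *m N = map_mx intr z.
Proof.
move=> /level_int[z zE] /level_int[z0 z0E]; exists (z - z0).
by rewrite raddfB /= -zE -z0E mulmxBl opprD addrACA subrr addr0.
Qed.

Lemma seq_inhabited : exists v, v \in s.
Proof.
have [n [y [a [Py a1 _]]]] : aff_hull P 0 by rewrite Pfull.
case: n y a Py a1 => [|n] y a Py a1.
  by move: a1; rewrite big_ord0 => /esym/eqP; rewrite oner_eq0.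
have [l [z [b [zs _ b1 _]]]] := Py ord0.
case: l z b zs b1 => [|l] z b zs b1.
  by move: b1; rewrite big_ord0 => /esym/eqP; rewrite oner_eq0.
by exists (z ord0); exact: zs.
Qed.

(** Moving along a vector killed by [N] does not change the levels, so the line
    through a vertex in its direction stays in [P]. *)
Lemma level_inj x : x *m N = 0 -> x = 0.
Proof.
move=> xN; have [v vs] := seq_inhabited.
apply: (@unbounded_ray R d s x v) => t; apply: level_ge0 => k.
rewrite mulmxDl -scalemxAl xN scaler0 addr0; apply: level_ge0P.
exact: sub_conv_hull.
Qed.

(** The hypotheses of [integral_lattice] are met by a basis of differences of
    vertices, on which [N] takes values in {-1, 0, 1}. *)
Lemma level_lattice :
  is_lattice [set x | exists z : 'rV[int]_m, x *m N = map_mx intr z].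
Proof.
have [v0 v0s] := seq_inhabited.
have [W [Wu Ws]] := vertex_basis v0 Pfull.
have /choice[M MP] : forall i, exists z : 'rV[int]_m, row i W *m N = map_mx intr z.
  by move=> i; have [v vs ->] := Ws i; exact: level_diff_int.
apply: (integral_lattice (W := W) (M := \matrix_i M i)) => //; last exact: level_inj.
by apply/row_matrixP => i; rewrite row_mul MP -map_row rowK.
Qed.

Lemma sum_quarter : m%:R / 4 = \sum_(k < m) 4^-1 :> R.
Proof. by rewrite sumr_const card_ord mulr_natl. Qed.

(** For an integer t one has (t - 1/2)^2 = 1/4 + t (t - 1), and the last
    product is a nonnegative integer that vanishes only for t = 0 and t = 1. *)
Lemma half_cube_dist (z : 'rV[int]_m) :
  let e := map_mx intr z - const_mx 2^-1 : 'rV[R]_m in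
  m%:R / 4 <= dotp e e /\ (dotp e e = m%:R / 4 -> forall k, z 0 k = 0 \/ z 0 k = 1).
Proof.
move=> e; pose q k := z 0 k * (z 0 k - 1).
have eE : dotp e e = m%:R / 4 + (\sum_k q k)%:~R.
  rewrite sum_quarter rmorph_sum -big_split; apply: eq_bigr => k _ /=.
  by rewrite -expr2 !mxE; case: (sub_half_sqr R (z 0 k)).
have q0 k : 0 <= q k by case: (sub_half_sqr R (z 0 k)).
rewrite eE lerDl ler0z sumr_ge0 //; split=> // H k.
have : (\sum_k q k)%:~R = 0 :> R by lra.
move/eqP; rewrite intr_eq0 psumr_eq0 // => /allP/(_ k).
rewrite mem_index_enum => /(_ isT)/eqP.
by case: (sub_half_sqr R (z 0 k)).
Qed.

(** The coordinates [x *m A + b] send [v0] to 0 and make the pulled-back norm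
    Euclidean.  The squared distance of [x] to the centre [o] is then that of
    its image to the centre of the cube, minus the squared distance [k0] of the
    cube's centre to the subspace ([dist]). *)
Lemma level_Delaunay : exists L D : set 'rV[R]_d,
  [/\ is_lattice L, lattice_Delaunay L D
    & exists (A : 'M[R]_d) (b : 'rV[R]_d),
        A \in unitmx /\ D = affine_image A b P].
Proof.
have [v0 v0s] := seq_inhabited.
have [A [Au AN]] := pullback_norm level_inj.
have [x0 x0E] := foot_of_perpendicular level_inj (c - const_mx 2^-1).
pose k0 := dotp (x0 *m N + (c - const_mx 2^-1)) (x0 *m N + (c - const_mx 2^-1)).
pose L := [set x *m A |
  x in [set x | exists z : 'rV[int]_m, x *m N = map_mx intr z]].
pose b := - (v0 *m A); pose o := (x0 - v0) *m A.
pose r2 := m%:R / 4 - k0.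
have xbo x : x *m A + b - o = (x - x0) *m A.
  by rewrite /b /o !mulmxBl; apply/rowP => i; rewrite !mxE; ring.
have dist x : dotp (x *m A + b - o) (x *m A + b - o) =
    dotp (x *m N + c - const_mx 2^-1) (x *m N + c - const_mx 2^-1) - k0.
  by rewrite xbo AN -!addrA x0E addrK.
have vL v : v \in s -> L (v *m A + b).
  by move=> vs; exists (v - v0); [exact: level_diff_int | rewrite mulmxBl].
have vS v : v \in s -> dotp (v *m A + b - o) (v *m A + b - o) = r2.
  move=> vs; rewrite dist /r2; congr (_ - _).
  rewrite sum_quarter; apply: eq_bigr => k _.
  rewrite -expr2 mxE [(- const_mx _) _ _]mxE [const_mx _ _ _]mxE.
  by have [->|->] := level01 k vs; field.
have Lx y : L y -> exists x (z : 'rV[int]_m),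
    y = x *m A + b /\ x *m N + c = map_mx intr z.
  move=> [x [z zE] <-]; have [z0 z0E] := level_int v0s.
  exists (x + v0), (z + z0); rewrite raddfD /= -zE -z0E !mulmxDl addrA.
  by rewrite addrK.
(* otherwise all the vertices would be at the centre *)
have r2_gt0 : 0 < r2.
  rewrite lt_neqAle -{2}(vS v0 v0s) dotp_ge0 andbT; apply/eqP => r20.
  have vx0 v : v \in s -> v = x0.
    move=> vs; apply/eqP; rewrite -subr_eq0; apply/eqP/level_inj/dotp_eq0.
    by rewrite -AN -xbo (vS v vs).
  have /rowP/(_ (Ordinal d_gt0)) : delta_mx 0 (Ordinal d_gt0) = 0 :> 'rV[R]_d.
    apply: (full_dim_const (m := dotp (delta_mx 0 (Ordinal d_gt0)) x0) Pfull).
    by apply: conv_hull_const => v /vx0 ->.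
  by rewrite !mxE !eqxx => /eqP; rewrite oner_eq0.
have sLS : affine_image A b [set y | y \in s] `<=` L `&` esphere o (Num.sqrt r2).
  move=> _ [v vs <-]; split; first exact: vL.
  by rewrite /esphere /= /enorm vS.
have LSP : L `&` esphere o (Num.sqrt r2) `<=` affine_image A b P.
  move=> y [/Lx[x [z [yE zE]]] yS]; exists x; last by rewrite yE.
  apply: level_ge0 => k; rewrite zE mxE ler0z.
  suff : z 0 k = 0 \/ z 0 k = 1 by case=> ->.
  apply: (half_cube_dist z).2; rewrite -zE.
  have := enorm_sqr (y - o); rewrite yS sqr_sqrtr ?(ltW r2_gt0) //.
  by rewrite yE dist /r2; lra.
have LDP : conv_hull (L `&` esphere o (Num.sqrt r2)) = affine_image A b P.
  apply/seteqP; split; last by rewrite affine_image_conv; exact: conv_hullS.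
  move=> y /(conv_hullS LSP); rewrite -affine_image_conv => -[x PPx <-].
  exists x => //; apply/conv_seqP => u k us.
  exact: (conv_hull_le (conv_hull_le us)) PPx.
exists L, (affine_image A b P); split.
- exact: lattice_image level_lattice.
- split.
    exists [seq v *m A + b | v <- s].
    rewrite affine_image_conv; congr conv_hull; apply/seteqP; split=> y /=.
      by move=> [v vs <-]; exact: map_f.
    by move=> /mapP[v vs ->]; exists v.
  exists o, (Num.sqrt r2); split.
  + by rewrite sqrtr_gt0.
  + by rewrite -LDP => v /vertex_conv_hull[].
  + apply/seteqP; split=> // y [/Lx[x [z [-> zE]]]].
    rewrite /open_eball /= /enorm ltr_sqrt // dist zE ltrBlDr subrK.
    by rewrite ltNge (half_cube_dist z).1.
  + by rewrite LDP.
- by exists A, b.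
Qed.

End DelaunaySphere.

Theorem mainTheorem2 (R : realType) (d : nat) (d_ge1 : (1 <= d)%N)
    (P : set 'rV[R]_d) (P_polytope : is_polytope P)
    (P_full : full_dimensional P) (P_perfect : perfect_prismoid P) :
  exists L D : set 'rV[R]_d,
    [/\ is_lattice L, lattice_Delaunay L D
      & exists (A : 'M[R]_d) (b : 'rV[R]_d),
          A \in unitmx /\ D = affine_image A b P].
Proof.
have [s [PE Pvert]] := polytope_vertices P_polytope.
have [m [N [c [N01 N0]]]] := level_map d_ge1 P_perfect P_full PE Pvert.
move: P_full N0; rewrite PE => P_full N0.
exact: level_Delaunay N01 N0.
Qed.
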